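(* Let $\mathcal{A}$ be a unital $C^*$-algebra and $a\in \mathcal{A}$. Then, for each of the two choices of sign $\pm$, $$v(a)=\frac{1}{\sqrt{2}} \max_{\lambda\in\mathbb{C},\,|\lambda|=1}\left\| Re(\lambda a)\pm Im(\lambda a)\right\|.$$
   Context: $\mathcal{A}$ is a unital $C^*$-algebra with unit $e$. $S(\mathcal{A})$ is the set of normalized states, i.e. continuous linear functionals $f$ on $\mathcal{A}$ with $f(e)=\|f\|=1$. The algebraic numerical radius of $a$ is $v(a)=\sup\{|f(a)|: f\in S(\mathcal{A})\}$. $Re(a)=\frac12(a+a^* )$ and $Im(a)=\frac{1}{2i}(a-a^* )$. *)

(* Defs.v *)
From HB Require Import structures.
From mathcomp Require Import all_boot all_order all_algebra.
From mathcomp Require Import complex.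
From mathcomp Require Import all_classical all_reals all_analysis.

Set Implicit Arguments.
Unset Strict Implicit.
Unset Printing Implicit Defensive.

Import Order.TTheory GRing.Theory Num.Theory.
Import numFieldNormedType.Exports.

Local Open Scope classical_set_scope.
Local Open Scope ring_scope.
Local Open Scope complex_scope.

(* In the library, a ring whose underlying group is normed has to be a
   [numDomainType], hence commutative, so that [algType R[i]] cannot be joined
   with [completeNormedModType R[i]]; the product is therefore given here on top
   of the Banach space structure.
   The zero algebra is not excluded: it has no states, and [sup set0 = 0]. *)
HB.mixin Record isCStarAlgebra (R : realType) A
    of CompleteNormedModule R[i] A := {
  cstar_mul : A -> A -> A ;
  cstar_unit : A ;
  cstar_mulA : associative cstar_mul ;
  cstar_mul1l : left_id cstar_unit cstar_mul ;
  cstar_mul1r : right_id cstar_unit cstar_mul ;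
  cstar_mulDl : left_distributive cstar_mul +%R ;
  cstar_mulDr : right_distributive cstar_mul +%R ;
  cstar_mulZl : forall (l : R[i]) (x y : A),
    cstar_mul (l *: x) y = l *: cstar_mul x y ;
  cstar_mulZr : forall (l : R[i]) (x y : A),
    cstar_mul x (l *: y) = l *: cstar_mul x y ;
  cstar_norm_mul : forall x y : A, `|cstar_mul x y| <= `|x| * `|y| ;
  star : A -> A ;
  starK : involutive star ;
  starD : forall x y : A, star (x + y) = star x + star y ;
  starZ : forall (l : R[i]) (x : A), star (l *: x) = l^* *: star x ;
  starM : forall x y : A, star (cstar_mul x y) = cstar_mul (star y) (star x) ;
  cstar_identity : forall x : A, `|cstar_mul (star x) x| = `|x| ^+ 2
}.

#[short(type="cstarAlgType")]
HB.structure Definition CStarAlgebra (R : realType) :=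
  {A of isCStarAlgebra R A & CompleteNormedModule R[i] A}.

(* The norm of a normed module over R[i] takes its values in the nonnegative
   real elements of R[i]; [rnorm] is the same norm as an element of R. *)
Definition rnorm (R : realType) (V : normedModType R[i]) (x : V) : R :=
  complex.Re `|x|.

Definition opnorm (R : realType) (V : normedModType R[i])
    (f : {linear V -> R[i]^o}) : R :=
  sup [set rnorm (f x) | x in [set x : V | rnorm x <= 1]].

Section CStar.
Variables (R : realType) (A : cstarAlgType R).

Definition re_part (a : A) : A := 2^-1 *: (a + star a).

Definition im_part (a : A) : A := (2 * 'i)^-1 *: (a - star a).

Definition states : set {linear A -> R[i]^o} :=
  [set f : {linear A -> R[i]^o} |
    [/\ continuous f, f cstar_unit = 1 & opnorm f = 1]].

Definition numerical_radius (a : A) : R := sup [set rnorm (f a) | f in states].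

End CStar.

Definition is_maximum (R : realType) (E : set R) (m : R) : Prop :=
  E m /\ ubound E m.

(* Main.v *)
(* Up to the rotation w = (1 -+ i) / sqrt 2, the element Re b +- Im b is
   sqrt 2 Re (w b), so the claim is v(a) = max_l ||Re (l a)||.  States are
   hermitian, so |f a| = f (Re (l a)) for a suitable l, which gives one
   inequality; the other one needs a state with |f h| = ||h|| for h selfadjoint.

   No spectral theory is used for the latter.  If x and y are commuting and
   selfadjoint, then x is the real part of x + iy, so that
   ||x||^2 <= ||x + iy||^2 = ||x^2 + y^2||.  Let ||h|| = 1.  Taking x = 2h and
   y = 1 - h^2 gives ||1 + h^2|| = 2, so by Hahn-Banach some functional F of norm
   at most 1 on the polynomials in h has F 1 = F (h^2) = 1.  The same inequality
   makes F nonnegative on squares, and F ((1 - h^2)^2) <= 0, so F vanishes on the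
   multiples of 1 - h^2 by Cauchy-Schwarz.  Choosing s = +-1 with F (sh) >= 0, we
   get F ((1 + sh)^(n+1)) = 2^n F (1 + sh) >= 2^n for all n, hence
   ||1 + sh|| = 2, and a functional norming 1 + sh is a state with f (sh) = 1. *)

From HB Require Import structures.
Require Import Defs.
From mathcomp Require Import all_boot all_order all_algebra.
From mathcomp Require Import complex ring lra.
From mathcomp Require Import all_classical all_reals all_analysis.

Import Order.TTheory GRing.Theory Num.Theory.
Import numFieldNormedType.Exports.

Local Open Scope classical_set_scope.
Local Open Scope ring_scope.
Local Open Scope complex_scope.

(** * Hahn-Banach *)

Section HahnBanach.
Context {R : realType} {V : lmodType R}.
Implicit Types (p q : V -> R) (x y a : V).

Definition sublinear p :=
  (forall x y, p (x + y) <= p x + p y) /\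
  (forall c x, 0 <= c -> p (c *: x) <= c * p x).

Lemma sublinear0 p : sublinear p -> p 0 = 0.
Proof.
move=> [pD pZ]; apply/eqP; rewrite eq_le; apply/andP; split.
  by have := pZ 0 0 (lexx _); rewrite scale0r mul0r.
by have := pD 0 0; rewrite addr0; lra.
Qed.

Lemma sublinearZ p c x : sublinear p -> 0 <= c -> p (c *: x) = c * p x.
Proof.
move=> sp; rewrite le0r => /orP[/eqP->|c0].
  by rewrite scale0r mul0r sublinear0.
apply/eqP; rewrite eq_le (sp.2 _ _ (ltW c0))/= -ler_pdivlMl//.
rewrite -[x in p x](scale1r x) -(mulVf (lt0r_neq0 c0)) -scalerA.
by apply: sp.2; rewrite invr_ge0 ltW.
Qed.

Lemma sublinear_leN p x : sublinear p -> - p (- x) <= p x.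
Proof.
by move=> sp; have := sp.1 x (- x); rewrite subrr (sublinear0 _ sp); lra.
Qed.

(** For sublinear [q] this is the largest sublinear functional below [q] whose value at [- a] is at
    most [- q a]. A linear functional below it therefore agrees with [q] at [a]. *)
Definition shift_inf q a x : R :=
  inf [set q (x + t *: a) - t * q a | t in [set t | 0 <= t]].

Lemma shift_inf_le q a x t : sublinear q -> 0 <= t ->
  shift_inf q a x <= q (x + t *: a) - t * q a.
Proof.
move=> sq t0; apply: ge_inf; last by exists t.
exists (- q (- x)) => _ [s /= s0 <-].
(* As [s q(a) = q(s a) <= q(x + s a) + q(- x)], the bound [- q(- x)] is uniform in [s]. *)
have := sq.1 (x + s *: a) (- x).
by rewrite [_ + - x]addrC addKr (sublinearZ _ s)//; lra.
Qed.

Lemma shift_inf_ge q a x m :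
  (forall t, 0 <= t -> m <= q (x + t *: a) - t * q a) -> m <= shift_inf q a x.
Proof.
move=> h; apply: lb_le_inf; first by exists (q (x + 0 *: a) - 0 * q a), 0 => /=.
by move=> _ [t /= t0 <-]; apply: h.
Qed.

(** Parameters [s] for [x] and [t] for [y] combine to [s + t] for [x + y]; a parameter [t] for [x]
    rescales to [c t] for [c x]. *)
Lemma sublinear_shift_inf q a : sublinear q -> sublinear (shift_inf q a).
Proof.
move=> sq; split=> [x y|c x].
  rewrite -lerBlDr; apply: shift_inf_ge => s s0.
  rewrite lerBlDr -lerBlDl; apply: shift_inf_ge => t t0.
  have := shift_inf_le q a (x + y) _ sq (addr_ge0 s0 t0).
  have := sq.1 (x + s *: a) (y + t *: a).
  by rewrite scalerDl addrACA mulrDl; lra.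
rewrite le0r => /orP[/eqP->|c0].
  have := shift_inf_le q a (0 *: x) _ sq (lexx _).
  by rewrite !scale0r addr0 (sublinear0 _ sq) !mul0r subr0.
rewrite -ler_pdivrMl//; apply: shift_inf_ge => t t0; rewrite ler_pdivrMl//.
have ct0 : 0 <= c * t by rewrite mulr_ge0// ltW.
have := shift_inf_le q a (c *: x) _ sq ct0.
by rewrite -scalerA -scalerDr (sublinearZ _ c _ sq (ltW c0)) mulrBr mulrA.
Qed.

Lemma exists_minimal_sublinear p : sublinear p -> exists q,
  [/\ sublinear q, forall x, q x <= p x &
   forall r, sublinear r -> (forall x, r x <= q x) -> r = q].
Proof.
move=> sp.
pose T := {q : V -> R | sublinear q /\ forall x, q x <= p x}.
(* The order is reversed, so that a maximal element for [Zorn] is a minimal functional. A nonempty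
   chain is bounded by its pointwise infimum. *)
pose ge (s t : T) := `[< forall x, sval t x <= sval s x >].
have [|||A tA|[q [sq qp]] qmin] := @Zorn T ge.
- by move=> t; apply/asboolP.
- move=> r s t /asboolP rs /asboolP st; apply/asboolP => x.
  exact: le_trans (st x) (rs x).
- move=> [s Ps] [t Pt] /asboolP/= st /asboolP/= ts.
  apply: eq_exist; apply/funext => x.
  by apply/eqP; rewrite eq_le st ts.
- have [[s0 As0]|A0] := pselect (exists s, A s); last first.
    exists (exist _ p (conj sp (fun=> lexx _))) => s As.
    by exfalso; apply: A0; exists s.
  pose q x := inf [set sval s x | s in A].
  have q_le s x : A s -> q x <= sval s x.
    move=> As; apply: ge_inf; last by exists s.
    (* The infimum is finite because [- p(- x) <= - t(- x) <= t(x)] for every [t] in the chain. *)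
    exists (- p (- x)) => _ [[t [st tp]] _ <-] /=.
    by have := sublinear_leN _ x st; have := tp (- x); lra.
  have q_ge m x : (forall s, A s -> m <= sval s x) -> m <= q x.
    move=> h; apply: lb_le_inf; first by exists (sval s0 x), s0.
    by move=> _ [s As <-]; apply: h.
  have Pq : sublinear q /\ forall x, q x <= p x.
    split; last by move=> x; apply: le_trans (q_le _ x As0) ((svalP s0).2 x).
    split=> [x y|c x].
      rewrite -lerBlDr; apply: (q_ge _ _) => s As.
      rewrite lerBlDr -lerBlDl; apply: (q_ge _ _) => t At.
      (* The smaller of the two functionals [s] and [t] is subadditive and bounds [q] at [x + y]. *)
      have [/asboolP h|/asboolP h] := tA s t As At.
        have := (svalP t).1.1 x y; have := h x; have := q_le t (x + y) At; lra.
      have := (svalP s).1.1 x y; have := h y; have := q_le s (x + y) As; lra.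
    rewrite le0r => /orP[/eqP->|c0].
      rewrite mul0r scale0r; apply: le_trans (q_le _ _ As0) _.
      by rewrite sublinear0//; exact: (svalP s0).1.
    rewrite -ler_pdivrMl//; apply: (q_ge _ _) => s As; rewrite ler_pdivrMl//.
    apply: le_trans (q_le _ _ As) _.
    by apply: (svalP s).1.2; exact: ltW.
  by exists (exist _ q Pq) => s As; apply/asboolP => x; exact: q_le.
- exists q; split=> // r sr rq.
  have Pr : sublinear r /\ forall x, r x <= p x.
    by split=> // x; exact: le_trans (rq x) (qp x).
  have rqE : exist _ r Pr = exist _ q (conj sq qp) :> T.
    by apply: qmin; apply/asboolP.
  exact: (congr1 (fun t : T => sval t) rqE).
Qed.

(** A minimal sublinear functional is additive, hence linear. Choosing it below [shift_inf p x0],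
    and not merely below [p], makes its value at [- x0] at most [- p x0], which forces equality at
    [x0]. *)
Theorem hahn_banach p x0 : sublinear p ->
  exists f : {scalar V}, (forall x, f x <= p x) /\ f x0 = p x0.
Proof.
move=> sp.
have sp0 := sublinear_shift_inf _ x0 sp.
have [q [sq qp qmin]] := exists_minimal_sublinear _ sp0.
have qle x : q x <= p x.
  apply: le_trans (qp x) _; have := shift_inf_le p x0 x _ sp (lexx _).
  by rewrite scale0r addr0 mul0r subr0.
(* [shift_inf q y] lies below [q], hence equals it by minimality; [t = 1] in the
   infimum then gives [q x <= q (x + y) - q y]. *)
have qD x y : q (x + y) = q x + q y.
  apply/eqP; rewrite eq_le sq.1/= -{1}(qmin _ (sublinear_shift_inf _ y sq)).
    have := shift_inf_le q y x _ sq ler01; rewrite scale1r mul1r; lra.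
  move=> z; have := shift_inf_le q y z _ sq (lexx _).
  by rewrite scale0r addr0 mul0r subr0.
have qN x : q (- x) = - q x.
  by have := qD x (- x); rewrite subrr (sublinear0 _ sq); lra.
have qZ : scalar q.
  move=> c x y; rewrite qD; congr (_ + _).
  have [c0|/ltW c0] := leP 0 c; first exact: sublinearZ.
  have := sublinearZ q (- c) x sq; rewrite oppr_ge0 scaleNr qN mulNr.
  by move=> /(_ c0)/oppr_inj.
pose qL := GRing.isLinear.Build _ _ _ _ q qZ.
pose f : {scalar V} := HB.pack q qL.
exists f; split=> //=; apply/eqP; rewrite eq_le qle/=.
have := qp (- x0); have := shift_inf_le p x0 (- x0) _ sp ler01.
by rewrite qN scale1r mul1r addNr (sublinear0 _ sp); lra.
Qed.
End HahnBanach.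

(** * Seminorms monotone on sums of squares *)

Section SquareMonotoneSeminorm.
Context {R : realType} {B : comAlgType R}.
(** The instance in view is the norm of [p(h)] for a real polynomial [p] and a fixed selfadjoint
    [h]. It can vanish at nonzero polynomials, hence only a seminorm. *)
Variable N : B -> R.
Hypothesis ND : forall x y, N (x + y) <= N x + N y.
Hypothesis NZ : forall c x, N (c *: x) = `|c| * N x.
Hypothesis NM : forall x y, N (x * y) <= N x * N y.
Hypothesis N1 : N 1 <= 1.
Hypothesis Nsqr : forall x y, N x ^+ 2 <= N (x ^+ 2 + y ^+ 2).

Lemma seminorm_ge0 x : 0 <= N x.
Proof.
have := ND x ((-1) *: x).
rewrite NZ normrN normr1 mul1r scaleN1r subrr.
have := NZ 0 0; rewrite scale0r normr0 mul0r => ->; lra.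
Qed.

Lemma seminorm_sublinear : sublinear N.
Proof. by split=> // c x c0; rewrite NZ ger0_norm. Qed.

Lemma seminormX x n : N (x ^+ n) <= N x ^+ n.
Proof.
elim: n => [|n IHn]; first by rewrite !expr0.
by rewrite !exprS (le_trans (NM _ _))// ler_wpM2l// seminorm_ge0.
Qed.

Lemma seminorm_1Dsqr h : N h = 1 -> 2 <= N (1 + h ^+ 2).
Proof.
move=> Nh; rewrite -(@ler_pXn2r _ 2)// ?nnegrE ?seminorm_ge0//.
apply: le_trans (seminormX (1 + h ^+ 2) 2).
have -> : (1 + h ^+ 2) ^+ 2 = (2 *: h) ^+ 2 + (1 - h ^+ 2) ^+ 2.
  by rewrite scaler_nat -mulr_natl; ring.
by apply: le_trans (Nsqr _ _); rewrite NZ Nh mulr1 ger0_norm.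
Qed.

Lemma dominated_ge0_sqr (F : {scalar B}) (x : B) :
  (forall y : B, F y <= N y) -> F 1 = 1 -> 0 <= F (x ^+ 2).
Proof.
move=> FN F1; set K := N (x ^+ 2).
have K0 : 0 <= K by exact: seminorm_ge0.
(* [(1 - 2d^2x^2)^2 + (2dx(1 - 2d^2x^2))^2 = 1 + O(d^4)], so [1 - 2d^2 F(x^2)]
   is at most [1 + O(d^4)]. *)
have key (d : R) : 0 <= d <= 1 -> - (2 * F (x ^+ 2)) * d ^+ 2 <=
    (12 * K ^+ 2 + 16 * K ^+ 3) * d ^+ 4.
  move=> /andP[d0 d1].
  (* The scalar [d] is embedded in [B] so that [ring] can expand the identity; [eE] translates back
     to scaling. *)
  pose e : B := d%:A.
  have eE k n u : k%:R * e ^+ n * u = (k%:R * d ^+ n) *: u.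
    rewrite /e exprZn expr1n -scalerAr mulr1 -scalerAl (mulr_natl u).
    by rewrite [in RHS]mulrC -scalerA scaler_nat.
  pose y := 1 - 2 * e ^+ 2 * x ^+ 2.
  pose z := 2 * e * x * y.
  have yz : y ^+ 2 + z ^+ 2 =
      1 + ((12 * d ^+ 4) *: (- (x ^+ 2) ^+ 2) + (16 * d ^+ 6) *: (x ^+ 2) ^+ 3).
    by rewrite -!eE /z /y; ring.
  have N2 : N (y ^+ 2 + z ^+ 2) <=
      1 + (12 * K ^+ 2 + 16 * K ^+ 3) * d ^+ 4.
    rewrite yz; apply: le_trans (ND _ _) _; apply: lerD => //.
    apply: le_trans (ND _ _) _; rewrite [leRHS]mulrDl; apply: lerD.
      rewrite NZ -scaleN1r NZ normrN normr1 mul1r.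
      rewrite ger0_norm ?mulr_ge0 ?exprn_ge0//.
      rewrite mulrAC ler_wpM2r ?exprn_ge0// ler_wpM2l//.
      exact: seminormX.
    rewrite NZ ger0_norm ?mulr_ge0 ?exprn_ge0// mulrAC.
    rewrite ler_pM ?mulr_ge0 ?exprn_ge0 ?seminorm_ge0//.
      by rewrite ler_wpM2l// seminormX.
    by rewrite ler_wiXn2l.
  have Fy : F y = 1 - 2 * d ^+ 2 * F (x ^+ 2).
    by rewrite /y eE linearB/= linearZ/= F1.
  have D0 : 0 <= (12 * K ^+ 2 + 16 * K ^+ 3) * d ^+ 4.
    by rewrite mulr_ge0 ?addr_ge0 ?mulr_ge0 ?exprn_ge0.
  (* With [D] the error term, [F y <= N y] and [N y ^+ 2 <= 1 + D <= (1 + D) ^+ 2] give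
     [F y <= 1 + D]. *)
  have := FN y; have := le_trans (Nsqr y z) N2; rewrite Fy.
  by move: D0; set D := _ * d ^+ 4; nra.
rewrite leNgt; apply/negP => Fx0.
pose C := 12 * K ^+ 2 + 16 * K ^+ 3; pose v := - (2 * F (x ^+ 2)).
have C0 : 0 <= C by rewrite addr_ge0// mulr_ge0// exprn_ge0.
have v0 : 0 < v by rewrite /v; lra.
have s0 : 0 < C + v + 1 by lra.
(* This [d] lies in []0, 1]] and satisfies [C d < v], so that [C d^2 < v], against [key]. *)
pose d := v / (C + v + 1).
have d0 : 0 < d by rewrite divr_gt0.
have dE : d * (C + v + 1) = v by rewrite divfK// gt_eqF.
have d1 : d <= 1 by nra.
have /key : 0 <= d <= 1 by rewrite ltW.
have -> : d ^+ 4 = d ^+ 2 * d ^+ 2 by rewrite -exprD.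
rewrite -/C -/v (mulrA C) ler_pM2r ?exprn_gt0//; nra.
Qed.

(** As [F (x ^+ 2) <= 0], the nonnegative function [t |-> F ((t x + y)^2)] lies below an affine one
    of slope [2 F (x * y)], which must then be zero. *)
Lemma CauchySchwarz_eq0 (F : {scalar B}) (x y : B) :
  (forall z : B, 0 <= F (z ^+ 2)) -> F (x ^+ 2) <= 0 -> F (x * y) = 0.
Proof.
move=> F0 Fx; apply/eqP/negPn/negP => Fxy.
have FE t : F ((t *: x + y) ^+ 2) =
    t ^+ 2 * F (x ^+ 2) + 2 * t * F (x * y) + F (y ^+ 2).
  have -> : (t *: x + y) ^+ 2 = t ^+ 2 *: x ^+ 2 + (2 * t) *: (x * y) + y ^+ 2.
    by rewrite sqrrD exprZn -scalerAl -scaler_nat scalerA.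
  by rewrite !linearD/= !linearZ.
(* At this [t] the affine bound [2 t F(x y) + F(y^2)] equals [-1]. *)
pose t := - (F (y ^+ 2) + 1) / (2 * F (x * y)).
have tE : 2 * t * F (x * y) = - (F (y ^+ 2) + 1) by rewrite /t; field.
have := F0 (t *: x + y); have := mulr_ge0_le0 (sqr_ge0 t) Fx.
by rewrite FE tE; lra.
Qed.

Lemma seminorm_1D_sign h : N h = 1 ->
  exists2 s : R, s = 1 \/ s = -1 & 2 <= N (1 + s *: h).
Proof.
move=> Nh.
have [F [FN Fh]] := hahn_banach N (1 + h ^+ 2) seminorm_sublinear.
have [F1 Fh2] : F 1 = 1 /\ F (h ^+ 2) = 1.
  have h2 : 2 <= F 1 + F (h ^+ 2) by rewrite -linearD Fh seminorm_1Dsqr.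
  have F1 : F 1 <= 1 by exact: le_trans (FN 1) N1.
  have Fh2 : F (h ^+ 2) <= 1.
    by apply: le_trans (FN _) _; have := seminormX h 2; rewrite Nh expr1n.
  by split; lra.
have Fsqr z : 0 <= F (z ^+ 2) by exact: dominated_ge0_sqr.
have Fe : F ((1 - h ^+ 2) ^+ 2) <= 0.
  have -> : (1 - h ^+ 2) ^+ 2 = 1 + (- 2) *: (h ^+ 2) + h ^+ 4.
    by rewrite scaleNr scaler_nat; ring.
  rewrite !linearD/= linearZ/= F1 Fh2.
  have := FN (h ^+ 4); have := seminormX h 4; rewrite Nh expr1n; lra.
pose s : R := if 0 <= F h then 1 else -1.
have s1 : s = 1 \/ s = -1 by rewrite /s; case: ifP; [left|right].
have ss : s * s = 1 by case: s1 => ->; lra.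
have Fsh : 0 <= s * F h by rewrite /s; case: (leP 0 (F h)); lra.
exists s => //.
have FX n : 2 ^+ n <= F ((1 + s *: h) ^+ n.+1).
  elim: n => [|n IHn]; first by rewrite expr0 expr1 linearD/= linearZ/= F1; lra.
  (* For [k = s h] one has [k^2 = h^2], so [(1 + k)^2 = 2 (1 + k) - (1 - h^2)], and [F] kills the
     multiples of [1 - h^2]. *)
  have -> : (1 + s *: h) ^+ n.+2 =
      2 *: (1 + s *: h) ^+ n.+1 + (-1) *: ((1 - h ^+ 2) * (1 + s *: h) ^+ n).
    rewrite (exprS _ n.+1) (exprS _ n) scaleN1r scaler_nat.
    have : (s *: h) * (s *: h) = h ^+ 2.
      by rewrite -scalerAl -scalerAr scalerA ss scale1r.
    move: (s *: h) => k kk; rewrite -kk; ring.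
  by rewrite linearD/= !linearZ/= CauchySchwarz_eq0// mulr0 addr0 exprS; lra.
rewrite leNgt; apply/negP; set M := N _ => M2.
have M0 : 0 <= M by exact: seminorm_ge0.
(* From [2^n <= F ((1 + s h)^(n+1)) <= M^(n+1)]; this contradicts the convergence of the powers of
   [M / 2 < 1] to 0. *)
have {}FX n : 2^-1 <= (M / 2) ^+ n.+1.
  rewrite expr_div_n ler_pdivlMr ?exprn_gt0// exprS mulKf//.
  by apply: le_trans (FX n) _; apply: le_trans (FN _) _; exact: seminormX.
have r1 : `|M / 2| < 1 by rewrite ger0_norm; lra.
have := cvg_expr r1 => /cvgrPdist_lt/(_ 2^-1 ltac:(by []))[n _ /(_ n.+1)/=].
rewrite sub0r normrN normrX ger0_norm; last by lra.
by move=> /(_ (leqnSn n)); rewrite ltNge FX.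
Qed.

End SquareMonotoneSeminorm.

(** * Complex normed spaces *)

Section ComplexNorm.
Context {R : realType}.

Lemma rnormE (V : normedModType R[i]) (x : V) : (rnorm x)%:C = `|x|.
Proof. by rewrite /rnorm RRe_real// realE normr_ge0. Qed.

Lemma rnorm_ge0 (V : normedModType R[i]) (x : V) : 0 <= rnorm x.
Proof. by rewrite -ler0c rnormE. Qed.

Lemma rnorm0 (V : normedModType R[i]) : rnorm (0 : V) = 0.
Proof. by rewrite /rnorm normr0. Qed.

Lemma rnormN (V : normedModType R[i]) (x : V) : rnorm (- x) = rnorm x.
Proof. by rewrite /rnorm normrN. Qed.

Lemma rnorm_eq0 (V : normedModType R[i]) (x : V) : rnorm x = 0 -> x = 0.
Proof. by move=> x0; apply/eqP; rewrite -normr_eq0 -rnormE x0. Qed.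

Lemma rnormD (V : normedModType R[i]) (x y : V) :
  rnorm (x + y) <= rnorm x + rnorm y.
Proof. by rewrite -lecR rmorphD/= !rnormE ler_normD. Qed.

Lemma rnormZ (V : normedModType R[i]) (l : R[i]) (x : V) :
  rnorm (l *: x) = rnorm (l : R[i]^o) * rnorm x.
Proof. by apply: complexI; rewrite rmorphM/= !rnormE normrZ. Qed.

Lemma rnormZr (V : normedModType R[i]) (c : R) (x : V) :
  rnorm (c%:C *: x) = `|c| * rnorm x.
Proof. by rewrite rnormZ /rnorm normc_def/= expr0n addr0 sqrtr_sqr. Qed.

Lemma sqr_rnormC (z : R[i]) :
  rnorm (z : R[i]^o) ^+ 2 = complex.Re z ^+ 2 + complex.Im z ^+ 2.
Proof. by apply: complexI; rewrite add_Re2_Im2 rmorphXn/= rnormE. Qed.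

Lemma rnorm_unit (z : R[i]) : `|z| = 1 -> rnorm (z : R[i]^o) = 1.
Proof. by rewrite /rnorm => ->. Qed.

Lemma Re_le_rnorm (z : R[i]) : complex.Re z <= rnorm (z : R[i]^o).
Proof.
by have := rnorm_ge0 _ (z : R[i]^o); have := sqr_rnormC z; nra.
Qed.

Lemma Re_rnorm_eq (z : R[i]) :
  rnorm (z : R[i]^o) <= complex.Re z -> z = (complex.Re z)%:C.
Proof.
move=> h; have z0 := rnorm_ge0 _ (z : R[i]^o); have := sqr_rnormC z.
move: h z0; case: z => a b /=; set r := rnorm _ => h r0 rE.
suff -> : b = 0 by [].
by apply/eqP; rewrite -sqrf_eq0; apply/eqP; nra.
Qed.

Lemma rnorm_rotate (z : R[i]) : exists2 l : R[i], `|l| = 1 &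
  l * z = (rnorm (z : R[i]^o))%:C.
Proof.
have [->|z0] := eqVneq z 0; first by exists 1; rewrite ?normr1// mulr0 rnorm0.
exists (`|z| / z).
  by rewrite normrM normrV ?unitfE// normr_id divff ?normr_eq0.
by rewrite divfK// -(rnormE R[i]^o).
Qed.

End ComplexNorm.

(** Restriction of scalars, under an alias so that the real module structure does not compete with
    the complex one on [V]. *)
Definition realified (R : rcfType) (V : lmodType R[i]) : Type := V.

Section Realified.
Context {R : rcfType} {V : lmodType R[i]}.

HB.instance Definition _ := GRing.Zmodule.on (realified R V).

Let scale (c : R) (x : realified R V) : realified R V := c%:C *: (x : V).

Let scaleA c d x : scale c (scale d x) = scale (c * d) x.
Proof. by rewrite /scale scalerA rmorphM. Qed.

Let scale1 : left_id 1 scale.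
Proof. by move=> x; rewrite /scale scale1r. Qed.

Let scaleDr : right_distributive scale +%R.
Proof. by move=> c x y; rewrite /scale scalerDr. Qed.

Let scaleDl x : {morph scale^~ x : c d / c + d}.
Proof. by move=> c d; rewrite /scale rmorphD scalerDl. Qed.

HB.instance Definition _ := GRing.Zmodule_isLmodule.Build R (realified R V)
  scaleA scale1 scaleDr scaleDl.

Lemma realified_scaleE (c : R) (x : realified R V) :
  c *: x = c%:C *: (x : V) :> V.
Proof. by []. Qed.

End Realified.

(* A real functional [g] is the real part of [x |-> g x - i g (i x)]. *)
Lemma norming_functional (R : realType) (V : normedModType R[i]) (x0 : V) :
  exists f : {linear V -> R[i]^o},
    (forall x, rnorm (f x) <= rnorm x) /\ f x0 = (rnorm x0)%:C.
Proof.
pose V' : lmodType R := realified R V.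
have [|g [g_le gx0]] := hahn_banach (fun x : V' => rnorm (x : V)) x0.
  split=> [x y|c x c0]; first exact: rnormD.
  by rewrite realified_scaleE rnormZr ger0_norm.
have gD (x y : V) : g (x + y : V) = g x + g y by exact: (linearD g).
have gZ (c : R) (x : V) : g (c%:C *: x : V) = c * g x.
  exact: (scalarZ g c (x : V')).
pose f (x : V) : R[i]^o := g x -i* g ('i *: x).
have f_linear : linear f.
  move=> [a b] x y.
  have cx : (a +i* b) *: x = a%:C *: x + b%:C *: ('i *: x).
    by rewrite scalerA -scalerDl; congr (_ *: _); simpc.
  have icx : 'i *: ((a +i* b) *: x) = a%:C *: ('i *: x) + (- b)%:C *: x.
    by rewrite !scalerA -scalerDl; congr (_ *: _); simpc.
  rewrite /f scalerDr icx cx !gD !gZ.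
  by apply/eqP; rewrite eq_complex /=; apply/andP; split; apply/eqP; ring.
pose fL := GRing.isLinear.Build _ _ _ _ f f_linear.
pose F : {linear V -> R[i]^o} := HB.pack f fL.
have F_le x : rnorm (F x) <= rnorm x.
  (* Rotating [x] makes the value of [F] real and nonnegative, so its modulus is a value of [g], at
     a vector of the same norm as [x]. *)
  have [l l1 lE] := rnorm_rotate (F x).
  have : F (l *: x) = (rnorm (F x))%:C by rewrite linearZ.
  move=> /(congr1 (@complex.Re _))/= <-.
  apply: le_trans (g_le _) _.
  by rewrite rnormZ rnorm_unit// mul1r.
exists F; split=> //.
(* The real part of [F x0] already reaches the bound on the modulus, so the imaginary part
   vanishes. *)
have FE : complex.Re (F x0) = rnorm x0 by exact: gx0.
by rewrite [LHS]Re_rnorm_eq FE.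
Qed.

(** * Polynomials in a selfadjoint element *)

Section CStarTheory.
Context {R : realType} {A : cstarAlgType R}.
Implicit Types x y z h : A.

Local Notation "x ** y" := (cstar_mul x y) (at level 40, left associativity).
Local Notation one := (@cstar_unit R A).

Lemma cstar_mul0l x : 0 ** x = 0.
Proof. by rewrite -(scale0r (0 : A)) cstar_mulZl !scale0r. Qed.

Lemma cstar_mul0r x : x ** 0 = 0.
Proof. by rewrite -(scale0r (0 : A)) cstar_mulZr !scale0r. Qed.

(* In [starZ] the conjugate is [Num.conj]; the lemmas of [complex] are about
   the convertible [conjc]. *)
Lemma starZc (l : R[i]) x : star (l *: x) = conjc l *: star x.
Proof. exact: starZ. Qed.

Lemma star0 : star (0 : A) = 0.
Proof. by rewrite -(scale0r (0 : A)) starZc conjc0 !scale0r. Qed.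

Lemma starN x : star (- x) = - star x.
Proof. by apply/eqP; rewrite -addr_eq0 -starD addNr star0. Qed.

Lemma star1 : star one = one.
Proof. by have := starM one (star one); rewrite cstar_mul1l starK cstar_mul1l. Qed.

Lemma rnormM x y : rnorm (x ** y) <= rnorm x * rnorm y.
Proof. by rewrite -lecR rmorphM/= !rnormE cstar_norm_mul. Qed.

Lemma rnorm_starM x : rnorm (star x ** x) = rnorm x ^+ 2.
Proof. by apply: complexI; rewrite rmorphXn/= !rnormE cstar_identity. Qed.

(** The square of the norm of [y] is the norm of [star y ** y], at most the product of the two
    norms; use this for [x] and for [star x]. *)
Lemma rnorm_star x : rnorm (star x) = rnorm x.
Proof.
suff le_star y : rnorm y <= rnorm (star y).
  by apply/eqP; rewrite eq_le le_star andbT -{2}(starK x) le_star.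
have := rnormM (star y) y; rewrite rnorm_starM.
by have := rnorm_ge0 _ y; have := rnorm_ge0 _ (star y); nra.
Qed.

(** The norm of the unit equals its own square; it is 0 in the zero algebra. *)
Lemma rnorm1_le1 : rnorm one <= 1.
Proof.
have := rnorm_starM one; rewrite star1 cstar_mul1l.
by have := rnorm_ge0 _ one; nra.
Qed.

Lemma sqr_rnorm_le_sum x y : star x = x -> star y = y -> x ** y = y ** x ->
  rnorm x ^+ 2 <= rnorm (x ** x + y ** y).
Proof.
move=> xs ys xy; pose z := x + 'i *: y.
have zs : star z = x - 'i *: y.
  by rewrite /z starD starZc xs ys -scaleNr; congr (_ + _ *: _); simpc.
(* The cross terms cancel because [x] and [y] commute. *)
have -> : x ** x + y ** y = star z ** z.
  rewrite zs cstar_mulDl -scaleNr cstar_mulZl !cstar_mulDr !cstar_mulZr.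
  rewrite scalerDr scalerA mulNr -expr2 sqr_i opprK scale1r xy.
  by rewrite scaleNr -addrA addNKr.
rewrite rnorm_starM ler_pXn2r ?nnegrE ?rnorm_ge0//.
have xE : (2 : R)%:C *: x = z + star z.
  have -> : (2 : R)%:C = 2 :> R[i] by exact: (rmorph_nat (real_complex R) 2).
  by rewrite zs /z addrACA subrr addr0 scaler_nat mulr2n.
have := rnormD _ z (star z); rewrite -xE rnorm_star rnormZr ger0_norm//.
lra.
Qed.

Section PolynomialCalculus.
Variable h : A.
Hypothesis hs : star h = h.

Definition cstar_pow n := iter n (cstar_mul h) one.

(** Evaluation at [h]. Real coefficients keep the values selfadjoint, and the values commute with
    each other. *)
Definition cstar_horner (p : {poly R}) : A :=
  \sum_(i < size p) (p`_i)%:C *: cstar_pow i.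

Lemma cstar_powSr n : cstar_pow n.+1 = cstar_pow n ** h.
Proof.
elim: n => [|n IHn]; first by rewrite /= cstar_mul1l cstar_mul1r.
by rewrite -[LHS]/(h ** cstar_pow n.+1) [in LHS]IHn cstar_mulA.
Qed.

Lemma star_cstar_pow n : star (cstar_pow n) = cstar_pow n.
Proof.
elim: n => [|n IHn]; first exact: star1.
by rewrite [in LHS]cstar_powSr starM hs IHn.
Qed.

(** Sums and multiples of polynomials may drop in size; this puts all of them over one common index
    range. *)
Lemma cstar_horner_widen n (p : {poly R}) : (size p <= n)%N ->
  cstar_horner p = \sum_(i < n) (p`_i)%:C *: cstar_pow i.
Proof.
move=> pn; rewrite /cstar_horner
  (big_ord_widen n (fun i => (p`_i)%:C *: cstar_pow i))//.
rewrite big_mkcond/=; apply: eq_bigr => i _; case: ltnP => // ip.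
by rewrite nth_default// scale0r.
Qed.

Lemma cstar_hornerD p q :
  cstar_horner (p + q) = cstar_horner p + cstar_horner q.
Proof.
pose n := maxn (size p) (size q).
rewrite (cstar_horner_widen n)//; last exact: leq_trans (size_polyD _ _) _.
rewrite (cstar_horner_widen n p) ?leq_maxl//.
rewrite (cstar_horner_widen n q) ?leq_maxr//.
rewrite -big_split/=; apply: eq_bigr => i _.
by rewrite coefD rmorphD scalerDl.
Qed.

Lemma cstar_hornerZ c p : cstar_horner (c *: p) = c%:C *: cstar_horner p.
Proof.
rewrite (cstar_horner_widen (size p)) ?size_scale_leq// scaler_sumr.
by apply: eq_bigr => i _; rewrite coefZ rmorphM scalerA.
Qed.

Lemma cstar_horner1 : cstar_horner 1 = one.
Proof. by rewrite (cstar_horner_widen 1) ?size_poly1// big_ord1 coef1 scale1r. Qed.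

Lemma cstar_hornerXM p : cstar_horner ('X * p) = h ** cstar_horner p.
Proof.
rewrite (cstar_horner_widen (size p).+1); last first.
  by apply: leq_trans (size_polyMleq _ _) _; rewrite size_polyX.
rewrite big_ord_recl coefXM eqxx scale0r add0r /cstar_horner.
rewrite (big_morph (cstar_mul h) (cstar_mulDr h) (cstar_mul0r h)).
by apply: eq_bigr => i _; rewrite cstar_mulZr coefXM.
Qed.

Lemma cstar_hornerM p q :
  cstar_horner (p * q) = cstar_horner p ** cstar_horner q.
Proof.
elim/poly_ind: p => [|p c IHp].
  by rewrite mul0r -(scale0r 0) cstar_hornerZ scale0r cstar_mul0l.
rewrite mulrDl cstar_hornerD [p * 'X]mulrC -mulrA cstar_hornerXM IHp.
rewrite cstar_hornerD cstar_mulDl cstar_hornerXM cstar_mulA; congr (_ + _).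
rewrite mul_polyC -alg_polyC !cstar_hornerZ.
by rewrite cstar_horner1 cstar_mulZl cstar_mul1l.
Qed.

Lemma star_cstar_horner p : star (cstar_horner p) = cstar_horner p.
Proof.
rewrite /cstar_horner (big_morph star starD star0); apply: eq_bigr => i _.
by rewrite starZc conjc_real star_cstar_pow.
Qed.

Lemma cstar_hornerX : cstar_horner 'X = h.
Proof.
rewrite -[X in cstar_horner X]mulr1 cstar_hornerXM cstar_horner1.
exact: cstar_mul1r.
Qed.

Lemma rnorm_1D_sign : rnorm h = 1 ->
  exists2 s : R, s = 1 \/ s = -1 & 2 <= rnorm (one + s%:C *: h).
Proof.
move=> h1.
have [||||||s s1 N2] :=
  seminorm_1D_sign (fun p => rnorm (cstar_horner p)) _ _ _ _ _ 'X.
- by move=> p q; rewrite cstar_hornerD rnormD.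
- by move=> c p; rewrite cstar_hornerZ rnormZr.
- by move=> p q; rewrite cstar_hornerM rnormM.
- by rewrite cstar_horner1 rnorm1_le1.
- move=> p q; rewrite cstar_hornerD !expr2 !cstar_hornerM -expr2.
  apply: sqr_rnorm_le_sum; rewrite ?star_cstar_horner//.
  by rewrite -!cstar_hornerM mulrC.
- by rewrite cstar_hornerX.
exists s => //; rewrite -cstar_horner1 -cstar_hornerX.
by rewrite -cstar_hornerZ -cstar_hornerD.
Qed.

End PolynomialCalculus.
End CStarTheory.

(** * States and the numerical radius *)

Section States.
Context {R : realType} {A : cstarAlgType R}.
Implicit Types (x h a : A) (f : {linear A -> R[i]^o}) (l : R[i]).

Local Notation "x ** y" := (cstar_mul x y) (at level 40, left associativity).
Local Notation one := (@cstar_unit R A).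

Lemma state_le f x : states f -> rnorm (f x) <= rnorm x.
Proof.
move=> [_ _]; rewrite /opnorm; set E := image _ _ => f1.
(* Without a supremum [sup] would take its default value 0, against [opnorm f = 1]. *)
have Eub : has_sup E.
  apply: contrapT => /sup_out E0; move: f1.
  by rewrite E0 => /eqP; rewrite eq_sym oner_eq0.
have [x0|x0] := eqVneq (rnorm x) 0.
  by rewrite (rnorm_eq0 _ x x0) linear0 !rnorm0.
have xp : 0 < rnorm x by rewrite lt_neqAle eq_sym x0 rnorm_ge0.
rewrite -[leRHS]mulr1 -ler_pdivrMl// -f1.
rewrite -[X in X * _]ger0_norm ?invr_ge0 ?rnorm_ge0// -rnormZr -linearZ.
apply: ub_le_sup; first exact: Eub.2.
exists ((rnorm x)^-1%:C *: x) => //=.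
by rewrite rnormZr ger0_norm ?invr_ge0 ?rnorm_ge0// mulVf.
Qed.

Lemma stateP f : f one = 1 -> (forall x, rnorm (f x) <= rnorm x) -> states f.
Proof.
move=> f1 f_le; split=> //.
  apply: bounded_linear_continuous; apply/linear_boundedP.
  near=> r => x; rewrite -!rnormE.
  apply: (@le_trans _ _ (1 * (rnorm x)%:C)).
    by rewrite mul1r lecR.
  rewrite ler_wpM2r ?ler0c ?rnorm_ge0//.
apply/eqP; rewrite eq_le; apply/andP; split.
  apply: ge_sup; first by exists (rnorm (f 0)), 0 => //=; rewrite rnorm0.
  by move=> _ [x /= x1 <-]; apply: le_trans (f_le x) x1.
have <- : rnorm (f one) = 1 by rewrite f1 /rnorm normr1.
apply: ub_le_sup; last by exists one => //=; exact: rnorm1_le1.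
by exists 1 => _ [x /= x1 <-]; apply: le_trans (f_le x) x1.
Unshelve. all: by end_near. Qed.

(** For [k = h / ||h||], a functional norming [1 + s k] has values of modulus at most 1 at the unit
    and at [s k], with real parts summing to at least 2. So it is 1 at the unit, and its value at
    [k] has modulus 1. That [h] is nonzero also excludes the zero algebra, which has no states. *)
Lemma state_norming h : star h = h -> h != 0 ->
  exists2 f, states f & rnorm h <= rnorm (f h).
Proof.
move=> hs h0; have hp : 0 < rnorm h.
  rewrite lt_neqAle rnorm_ge0 andbT eq_sym.
  by apply: contra h0 => /eqP/rnorm_eq0->.
pose k := (rnorm h)^-1%:C *: h.
have k1 : rnorm k = 1 by rewrite rnormZr gtr0_norm ?invr_gt0// mulVf ?gt_eqF.
have ks : star k = k by rewrite starZc conjc_real hs.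
have [s s1 N2] := rnorm_1D_sign k ks k1.
have [f [f_le fE]] := norming_functional R A (one + s%:C *: k).
have sk1 : rnorm (s%:C *: k) = 1.
  by rewrite rnormZr k1 mulr1; case: s1 => ->; rewrite ?normrN normr1.
have Re2 : 2 <= complex.Re (f one) + complex.Re (f (s%:C *: k)).
  by have := congr1 (@complex.Re _) fE; rewrite linearD raddfD/= => ->.
have fone : rnorm (f one) <= 1 := le_trans (f_le _) rnorm1_le1.
have fk : rnorm (f (s%:C *: k)) <= 1 by rewrite -sk1 f_le.
have Reone := Re_le_rnorm (f one); have Rek := Re_le_rnorm (f (s%:C *: k)).
exists f.
  apply: stateP => //; rewrite (Re_rnorm_eq (f one)); last by lra.
  by rewrite (_ : complex.Re _ = 1)//; lra.
have : 1 <= rnorm (f (s%:C *: k)) by lra.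
have -> : rnorm (f (s%:C *: k)) = (rnorm h)^-1 * rnorm (f h).
  rewrite !linearZ/= !rnormZr (@ger0_norm _ _^-1) ?invr_ge0 ?rnorm_ge0//.
  by case: s1 => ->; rewrite ?normrN normr1 mul1r.
by rewrite ler_pdivlMl// mulr1.
Qed.

Lemma state_selfadjoint f h : states f -> star h = h -> complex.Im (f h) = 0.
Proof.
move=> sf hs; set b := complex.Im (f h).
(* [|f (h + it)|^2 <= ||h + it||^2 = ||h^2 + t^2||] for every real [t]. *)
have bound t : 2 * b * t + b ^+ 2 <= rnorm h ^+ 2.
  pose k := h + (t%:C * 'i) *: one.
  have ks : star k = h - (t%:C * 'i) *: one.
    rewrite starD starZc hs star1 -scaleNr; congr (_ + _ *: _).
    by simpc.
  have kk : star k ** k = h ** h + (t ^+ 2)%:C *: one.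
    rewrite ks cstar_mulDl -scaleNr cstar_mulZl !cstar_mulDr !cstar_mulZr.
    rewrite !cstar_mul1l cstar_mul1r -addrA; congr (_ + _).
    rewrite scalerDr scaleNr addNKr scalerA; congr (_ *: _).
    by simpc.
  have le1 : rnorm (f k) ^+ 2 <= rnorm h ^+ 2 + t ^+ 2.
    apply: (@le_trans _ _ (rnorm k ^+ 2)).
      by rewrite ler_pXn2r ?nnegrE ?rnorm_ge0// state_le.
    rewrite -rnorm_starM kk; apply: le_trans (rnormD _ _ _) _.
    rewrite rnormZr ger0_norm ?sqr_ge0//; apply: lerD.
      by apply: le_trans (rnormM _ _) _; rewrite expr2.
    by rewrite ler_piMr ?sqr_ge0// rnorm1_le1.
  have [_ f1 _] := sf.
  have fk : f k = complex.Re (f h) +i* (b + t).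
    rewrite linearD linearZ f1 /b; case: (f h) => u v /=.
    by apply/eqP; rewrite eq_complex; simpc.
  move: le1; rewrite sqr_rnormC fk /=.
  by have := sqr_ge0 (complex.Re (f h)); nra.
apply/eqP/negPn/negP => b0.
(* This [t] makes [2 b t] exceed the bound by 1. *)
have := bound ((rnorm h ^+ 2 + 1) / (2 * b)).
have -> : 2 * b * ((rnorm h ^+ 2 + 1) / (2 * b)) = rnorm h ^+ 2 + 1 by field.
by have := sqr_ge0 b; lra.
Qed.

Lemma state_re_part f a : states f -> f (re_part a) = (complex.Re (f a))%:C.
Proof.
move=> sf.
(* Together [imD] and [imB] say that [f (star a)] is the conjugate of [f a]. *)
have imD : complex.Im (f (a + star a)) = 0.
  by apply: state_selfadjoint => //; rewrite starD starK addrC.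
have imB : complex.Im (f ('i *: (a - star a))) = 0.
  apply: state_selfadjoint => //; rewrite starZc starD starN starK.
  by rewrite -opprB scalerN -scaleNr; congr (_ *: _); simpc.
rewrite /re_part linearZ/=.
have -> : f (a + star a) = 2 * (complex.Re (f a))%:C.
  rewrite linearZ linearB/= in imB; rewrite linearD/= in imD *.
  move: imD imB; case: (f a) => u v; case: (f (star a)) => u' v' /=.
  rewrite !mul0r !mul1r => im1 im2.
  apply/eqP; rewrite eq_complex; simpc => /=.
  by apply/andP; split; apply/eqP; lra.
by rewrite [LHS]mulrA mulVf ?mul1r// pnatr_eq0.
Qed.

(** * Comparison of the numerical radius with the norms of [Re(l a)] *)

Lemma numerical_radius_ge f a : states f -> rnorm (f a) <= numerical_radius a.
Proof.
move=> sf; apply: ub_le_sup; last by exists f.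
by exists (rnorm a) => _ [g sg <-]; exact: state_le.
Qed.

Lemma numerical_radius_ge0 a : 0 <= numerical_radius a.
Proof.
have [[f sf]|nost] := pselect (exists f : {linear A -> R[i]^o}, states f).
  exact: le_trans (rnorm_ge0 _ _) (numerical_radius_ge f a sf).
rewrite /numerical_radius (_ : image _ _ = set0) ?sup0//.
by rewrite -subset0 => r [f sf _]; apply: nost; exists f.
Qed.

Lemma star_re_part a : star (re_part a) = re_part a.
Proof.
rewrite /re_part starZc starD starK addrC; congr (_ *: _).
by rewrite conjc_inv conjc_nat.
Qed.

(** A state norming the selfadjoint element [Re(l a)] takes there the value [Re(l f(a))], of modulus
    at most [|f(a)|]. *)
Lemma rnorm_re_part_le a l : `|l| = 1 ->
  rnorm (re_part (l *: a)) <= numerical_radius a.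
Proof.
move=> l1; have [->|re0] := eqVneq (re_part (l *: a)) 0.
  by rewrite rnorm0 numerical_radius_ge0.
have [f sf h_le] := state_norming _ (star_re_part (l *: a)) re0.
apply: le_trans h_le _; apply: le_trans (numerical_radius_ge f a sf).
rewrite state_re_part// linearZ/= -[leRHS]mul1r -(rnorm_unit l l1) -rnormZ.
have := sqr_rnormC (l *: f a); have := sqr_rnormC (complex.Re (l *: f a))%:C.
move=> /= E1 E2.
rewrite -(@ler_pXn2r _ 2) ?nnegrE ?rnorm_ge0// E1 E2.
by rewrite expr0n/= addr0 lerDl sqr_ge0.
Qed.

Lemma state_le_rnorm_re_part f a : states f ->
  exists2 l : R[i], `|l| = 1 & rnorm (f a) <= rnorm (re_part (l *: a)).
Proof.
move=> sf; have [l l1 lE] := rnorm_rotate (f a).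
exists l => //; apply: le_trans (state_le f _ sf).
have lfa : f (l *: a) = (rnorm (f a))%:C by rewrite linearZ.
by rewrite state_re_part// lfa; exact: (Re_le_rnorm (rnorm (f a))%:C).
Qed.

(** The condition [0 <= m] covers the case without states, where the radius is the supremum of the
    empty set, that is 0. *)
Lemma numerical_radius_le a m : 0 <= m ->
  (forall l, `|l| = 1 -> rnorm (re_part (l *: a)) <= m) ->
  numerical_radius a <= m.
Proof.
move=> m0 le_m.
have [[f sf]|nost] := pselect (exists f : {linear A -> R[i]^o}, states f).
  apply: ge_sup; first by exists (rnorm (f a)), f.
  move=> _ [g sg <-]; have [l l1 g_le] := state_le_rnorm_re_part g a sg.
  exact: le_trans g_le (le_m l l1).
rewrite /numerical_radius (_ : image _ _ = set0) ?sup0//.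
by rewrite -subset0 => r [f sf _]; apply: nost; exists f.
Qed.

(** Writes [Re(l a)] as a real combination of two fixed elements, which makes its norm continuous in
    [l]. *)
Lemma re_part_combination (c d : R) a :
  re_part ((c +i* d) *: a) = c%:C *: re_part a + d%:C *: re_part ('i *: a).
Proof.
rewrite /re_part !starZc !scalerA -![_%:C * 2^-1]mulrC.
rewrite -!(scalerA 2^-1) -scalerDr.
congr (_ *: _); rewrite !scalerDr !scalerA addrACA -!scalerDl.
by congr (_ *: _ + _ *: _); simpc.
Qed.

Lemma re_partN a : re_part (- a) = - re_part a.
Proof. by rewrite /re_part starN -opprD scalerN. Qed.

Lemma rnorm_combination_continuous (T : topologicalType) (c d : T -> R) x y :
  continuous c -> continuous d ->
  continuous (fun t => rnorm ((c t)%:C *: x + (d t)%:C *: y)).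
Proof.
move=> cc cd t; apply/cvgrPdist_lt => e e0.
have D0 :
  `|c t - c s| * rnorm x + `|d t - d s| * rnorm y @[s --> t] --> (0 : R).
  rewrite -[0](_ : `|c t - c t| * rnorm x + `|d t - d t| * rnorm y = 0);
    last first.
    by rewrite !subrr normr0 !mul0r addr0.
  apply: cvgD; apply: cvgMl; apply: cvg_norm; apply: cvgB;
    by [exact: cvg_cst|exact: cc|exact: cd].
have /cvgrPdist_lt/(_ e e0) := D0; apply: filterS => s.
rewrite sub0r normrN; apply: le_lt_trans.
rewrite [leRHS]ger0_norm ?addr_ge0 ?mulr_ge0 ?rnorm_ge0//.
rewrite -!rnormZr !rmorphB !scalerBl.
have tri (u v : A) : `|rnorm u - rnorm v| <= rnorm (u - v).
  have := rnormD _ (u - v) v; have := rnormD _ (v - u) u.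
  by rewrite !subrK -(rnormN _ (v - u)) opprB ler_norml; lra.
apply: le_trans (tri _ _) _; apply: le_trans _ (rnormD _ _ _).
by rewrite opprD addrACA.
Qed.

(* As the norm does not change under [l |-> -l], it suffices to maximize over
   the upper half circle [t + i sqrt (1 - t^2)]. *)
Lemma exists_max_re_part a : exists2 l0 : R[i], `|l0| = 1 &
  forall l, `|l| = 1 -> rnorm (re_part (l *: a)) <= rnorm (re_part (l0 *: a)).
Proof.
pose c (t : R) : R[i] := t +i* Num.sqrt (1 - t ^+ 2).
have c1 t : -1 <= t <= 1 -> `|c t| = 1.
  move=> /andP[t0 t1]; rewrite normc_def/= sqr_sqrtr; last by nra.
  by rewrite addrC subrK sqrtr1.
have cont : continuous (fun t => rnorm (re_part (c t *: a))).
  under eq_fun do rewrite re_part_combination.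
  apply: rnorm_combination_continuous => [t|t]; first exact: cvg_id.
  apply: continuous_comp; last exact: sqrt_continuous.
  by apply: cvgB; [exact: cvg_cst|exact: exprn_continuous].
have [|t0 t01 t0max] := @EVT_max R _ (-1) 1 _ (continuous_subspaceT cont).
  by lra.
exists (c t0); first by apply: c1; rewrite in_itv in t01.
move=> [u v] l1.
have uv : u ^+ 2 + v ^+ 2 = 1.
  have := sqr_rnormC (u +i* v); rewrite rnorm_unit//= expr1n; by [].
have uI : u \in `[-1, 1]%R /\ - u \in `[-1, 1]%R.
  by rewrite !in_itv/=; split; nra.
have [v0|v0] := leP 0 v.
  apply: le_trans (t0max u uI.1).
  by rewrite /c (_ : 1 - _ = v ^+ 2) ?sqrtr_sqr ?ger0_norm//; lra.
apply: le_trans (t0max (- u) uI.2).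
rewrite -rnormN -re_partN -scaleNr /c sqrrN (_ : 1 - _ = v ^+ 2); last by lra.
by rewrite sqrtr_sqr ltr0_norm.
Qed.

Lemma re_part_im_part (e : R) : e ^+ 2 = 1 -> exists2 w : R[i], `|w| = 1 &
  forall b : A, re_part b + e%:C *: im_part b =
    (Num.sqrt 2)%:C *: re_part (w *: b).
Proof.
(* As [Im b = Re(- i b)], the left side is [Re((1 - i e) b)], and [1 - i e] has modulus [sqrt 2];
   the sign [e] handles both cases at once. *)
move=> e1; exists ((Num.sqrt 2)^-1 -i* (e / Num.sqrt 2)).
  rewrite normc_def/= sqrrN expr_div_n e1 exprVn sqr_sqrtr//.
  by rewrite (_ : _ + _ = 1) ?sqrtr1//; lra.
have s2 : Num.sqrt 2 != 0 :> R by rewrite gt_eqF// sqrtr_gt0.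
have iV : (2 * 'i : R[i])^-1 = 2^-1 * (- 'i).
  rewrite invfM; congr (_ * _).
  have i0 : 'i != 0 :> R[i] by rewrite eq_complex/= oner_eq0 andbF.
  by apply: (mulfI i0); rewrite divff// mulrN -expr2 sqr_i opprK.
move=> b; rewrite /re_part /im_part iV starZc !scalerA.
rewrite mulrCA -[_%:C * 2^-1]mulrC -!(scalerA 2^-1) -scalerDr; congr (_ *: _).
have -> k : b + star b + k *: (b - star b) = (1 + k) *: b + (1 - k) *: star b.
  by rewrite scalerBr addrACA scalerDl scalerBl !scale1r.
rewrite scalerDr !scalerA.
by congr (_ *: _ + _ *: _); apply/eqP; rewrite eq_complex; simpc;
  rewrite /= ?divff// mulrCA divff// ?mulr1 ?eqxx.
Qed.

Lemma numerical_radius_max (e : R) a : e ^+ 2 = 1 -> exists2 m : R,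
  is_maximum [set rnorm (re_part (l *: a) + e%:C *: im_part (l *: a))
             | l in [set l : R[i] | `|l| = 1]] m
  & numerical_radius a = (Num.sqrt 2)^-1 * m.
Proof.
move=> /re_part_im_part[w w1 wE]; have [l0 l01 l0max] := exists_max_re_part a.
have w0 : w != 0 by rewrite -normr_eq0 w1 oner_eq0.
have s2 : 0 < Num.sqrt 2 :> R by rewrite sqrtr_gt0.
have TE l : rnorm (re_part (l *: a) + e%:C *: im_part (l *: a)) =
    Num.sqrt 2 * rnorm (re_part ((w * l) *: a)).
  by rewrite wE rnormZr gtr0_norm// scalerA.
exists (Num.sqrt 2 * rnorm (re_part (l0 *: a))).
  split=> [|_ [l /= l1 <-]].
    (* Multiplication by [w] permutes the unit circle, so the maximizer [l0] for [Re(l a)] is pulled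
       back along it. *)
    exists (w^-1 * l0).
      by rewrite /= normrM normrV ?unitfE// w1 l01 invr1 mulr1.
    by rewrite TE mulrA divff// mul1r.
  by rewrite TE ler_pM2l// l0max// normrM w1 l1 mulr1.
rewrite mulKf ?gt_eqF//; apply/eqP; rewrite eq_le rnorm_re_part_le// andbT.
by apply: numerical_radius_le; rewrite ?rnorm_ge0.
Qed.
End States.

Theorem proposition2p4 (R : realType) (A : cstarAlgType R) (a : A) :
  (exists2 m : R,
     is_maximum [set rnorm (re_part (l *: a) + im_part (l *: a))
                | l in [set l : R[i] | `|l| = 1]] m
     & numerical_radius a = (Num.sqrt 2)^-1 * m)
  /\
  (exists2 m : R,
     is_maximum [set rnorm (re_part (l *: a) - im_part (l *: a))
                | l in [set l : R[i] | `|l| = 1]] m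
     & numerical_radius a = (Num.sqrt 2)^-1 * m).
Proof.
split.
  have [m mmax mE] := numerical_radius_max 1 a (expr1n _ 2).
  exists m => //; suff <- : (fun l : R[i] =>
      rnorm (re_part (l *: a) + (1 : R)%:C *: im_part (l *: a))) =
      (fun l => rnorm (re_part (l *: a) + im_part (l *: a))) by [].
  by apply/funext => l; rewrite scale1r.
have [|m mmax mE] := numerical_radius_max (-1) a; first by rewrite sqrrN expr1n.
exists m => //; suff <- : (fun l : R[i] =>
    rnorm (re_part (l *: a) + (- 1 : R)%:C *: im_part (l *: a))) =
    (fun l => rnorm (re_part (l *: a) - im_part (l *: a))) by [].
by apply/funext => l; rewrite rmorphN scaleN1r.
Qed.
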